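(* Consider the single energy arrival problem with initial temperature $T(0)$, and let $P(t)$ be the optimal policy and $T(t)$ the resulting temperature. (i) Suppose $T_e<T(0)<T_c$. Then $P(t)$ is monotone decreasing (non-increasing) on $[0,D]$. Let $t_h=\min\{t\in[0,D]:T(t)=T_c\}$. If $t_h$ exists and $t_h<D$, then $P(t)=\frac{T_\delta b}{a}$ for all $t\in[t_h,D]$, and the temperature $T(t)$ is monotone increasing (non-decreasing) and concave on $[0,D]$. (ii) If $T(0)=T_c$, then $P(t)=\min\left\{\frac{T_\delta b}{a},\frac ED\right\}$ for all $t\in[0,D]$.
   Context: Single energy arrival problem with initial temperature $T(0)\in[T_e,T_c]$: fix a deadline $D>0$, an available energy $E>0$, constants $a,b>0$, an environment temperature $T_e$ and a critical temperature $T_c>T_e$; set $T_\delta=T_c-T_e$. A power policy is a measurable function $P:[0,D]\to[0,\infty)$. The resulting temperature $T(t)$ solves $\frac{d}{dt}T(t)=aP(t)-b(T(t)-T_e)$ with the given initial value $T(0)$, i.e. $T(t)=T_e+e^{-bt}\left(T(0)-T_e+\int_0^t ae^{b\tau}P(\tau)\,d\tau\right)$. The optimal policy is the maximizer of $\int_0^D\frac12\log_2(1+P(\tau))\,d\tau$ over power policies satisfying $T(t)\le T_c$ for all $t\in[0,D]$ and $\int_0^DP(\tau)\,d\tau\le E$. It is unique almost everywhere; pointwise statements about it are understood after modification on a null set. *)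

(* Defs.v *)
(* MathComp-Analysis *)
From HB Require Import structures.
From mathcomp Require Import all_boot all_order all_algebra.
From mathcomp Require Import all_classical all_reals all_analysis.
Set Implicit Arguments.
Unset Strict Implicit.
Unset Printing Implicit Defensive.
Import Order.TTheory GRing.Theory Num.Theory.
Import numFieldNormedType.Exports.
Local Open Scope classical_set_scope.
Local Open Scope ring_scope.

Section SingleEnergyArrival.
Context {R : realType}.
Implicit Types (D E a b Te Tc t : R) (P : R -> R).

Notation mu := (@lebesgue_measure R).

Definition log2 (x : R) : R := ln x / ln 2.

(* Policies are total functions R -> R of which only the values on [0, D]
   matter; measurability is with respect to the Borel sets of R. *)
Definition power_policy D P : Prop :=
  measurable_fun `[0, D] P /\ {in `[0, D], forall t, 0 <= P t}.

(* The real-valued integral is 0 when the integrand has infinite integral; this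
   cannot happen for a policy that meets the energy budget of [feasible]. *)
Definition temperature a b Te (T0 : R) P t : R :=
  Te + expR (- b * t) *
    (T0 - Te + \int[mu]_(tau in `[0, t]) (a * expR (b * tau) * P tau)).

Definition energy D P : \bar R := (\int[mu]_(tau in `[0%R, D]) (P tau)%:E)%E.

Definition throughput D P : \bar R :=
  (\int[mu]_(tau in `[0%R, D]) (2^-1 * log2 (1 + P tau))%:E)%E.

Definition feasible D E a b Te Tc (T0 : R) P : Prop :=
  [/\ power_policy D P,
      {in `[0, D], forall t, temperature a b Te T0 P t <= Tc} &
      (energy D P <= E%:E)%E].

Definition optimal D E a b Te Tc (T0 : R) P : Prop :=
  feasible D E a b Te Tc T0 P /\
  forall P', feasible D E a b Te Tc T0 P' ->
    (throughput D P' <= throughput D P)%E.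

Definition is_min (A : set R) t : Prop := A t /\ lbound A t.

Definition concave_function (A : set R) (f : R -> R) : Prop :=
  convex_function A (\- f).

End SingleEnergyArrival.

(* Main.v *)
(* Replacing an optimal policy P by its mean m on [s, u] keeps the energy and,
   unless P = m there, raises the throughput.  Under constant power the
   temperature is monotone, so the new policy is feasible as soon as it does not
   heat more by time u, that is as soon as e^(b t) and P - m are nonnegatively
   correlated on [s, u].  This is the case when t |-> int_0^t P lies below its
   chord over [s, u]; hence t |-> int_0^t P is concave and P has a nonincreasing
   version.
     Let pc = b (Tc - Te) / a be the power that maintains Tc, and let Tc be
   reached first at th < D.  Then P > pc before th and P <= pc after it; if P were
   not equal to pc after th, there would be s < th < u with mean power pc on
   [s, u], and averaging there contradicts optimality. *)
Require Import Defs.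
From mathcomp Require Import all_boot all_order all_algebra.
From mathcomp Require Import all_classical all_reals all_analysis.
From mathcomp Require Import measurable_realfun ring lra.
Import Order.TTheory GRing.Theory Num.Theory.
Import numFieldNormedType.Exports.
Local Open Scope classical_set_scope.
Local Open Scope ring_scope.

Set Implicit Arguments.
Unset Strict Implicit.
Unset Printing Implicit Defensive.

(** * Integrals over compact intervals *)

Section RealAnalysis.
Context {R : realType}.
Implicit Types (f g h p F P : R -> R) (b c d e s t u x y z : R) (A : set R).

Notation mu := (@lebesgue_measure R).

(** Three choices shape the proof. The tangent inequality of [ln] is taken at the competing policy
    P', not at the optimal P. Where P' is constant, the factor 1 / (1 + P') leaves the integral, so
    the first-order gain of an averaged policy is a multiple of the change of energy, and nothing
    about P beyond its integrals is needed. The temperature cap is rewritten as a bound on e^(b t)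
    (Tc - T(t)), which is affine in the policy and is driven only by the sign of P - pc. Concavity
    of the cumulative energy does not by itself give a nonincreasing version of P on the closed
    interval: the slope at 0 could be infinite, whereas a real-valued nonincreasing function on
    [0, D] is bounded by its value at 0. A separate exchange excludes this: energy spent at a very
    high level has so small a marginal throughput that spending it late is better, even after a loss
    by the factor e^(b D) that pays for the heat. *)

Definition loc_integrable f :=
  forall x y, mu.-integrable `[x, y] (EFin \o f).

Definition integ f x y : R := \int[mu]_(t in `[x, y]) f t.

Lemma loc_integrable_measurable f A : loc_integrable f ->
  measurable A -> measurable_fun A f.
Proof.
move=> lf mA; apply: (@measurable_funS _ _ _ _ setT) => //.
have -> : [set: R] = \bigcup_n `[- n%:R, n%:R]%classic.
  apply/seteqP; split => // t _.
  have [n tn] : exists n, `|t| <= n%:R.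
    by exists (Num.bound `|t|); rewrite ltW// archi_boundP.
  by exists n => //=; rewrite in_itv/= -ler_norml.
apply/measurable_fun_bigcup => // n.
by have /integrableP[/measurable_EFinP + _] := lf (- n%:R) n%:R; exact.
Qed.

Lemma loc_integrable_dom f g :
  (forall x y, measurable_fun `[x, y] g) -> loc_integrable f ->
  (forall x y, exists C, forall t, t \in `[x, y] -> `|g t| <= C * `|f t|) ->
  loc_integrable g.
Proof.
move=> mg lf gf x y; have [C gC] := gf x y.
apply: (@le_integrable _ _ _ mu _ _ _ (EFin \o (fun t => C * f t))) => //.
- have /measurable_EFinP := mg x y; exact.
- move=> t xyt; rewrite [leLHS]/= [leRHS]/= lee_fin normrM.
  by apply: le_trans (gC _ xyt) _; rewrite ler_wpM2r// ler_norm.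
- by apply: (integrableZl _ C (lf x y)).
Qed.

Lemma loc_integrableD f g : loc_integrable f -> loc_integrable g ->
  loc_integrable (fun t => f t + g t).
Proof.
by move=> lf lg x y; apply: (integrableD _ (lf x y) (lg x y)).
Qed.

Lemma loc_integrableZ c f : loc_integrable f ->
  loc_integrable (fun t => c * f t).
Proof.
by move=> lf x y; apply: (integrableZl _ c (lf x y)).
Qed.

Lemma loc_integrableB f g : loc_integrable f -> loc_integrable g ->
  loc_integrable (fun t => f t - g t).
Proof.
by move=> lf lg x y; apply: (integrableB _ (lf x y) (lg x y)).
Qed.

Lemma continuous_loc_integrable f : continuous f -> loc_integrable f.
Proof.
move=> cf x y; apply: continuous_compact_integrable.
  exact: segment_compact.
exact: continuous_subspaceT.
Qed.

Lemma loc_integrable_cst c : loc_integrable (fun=> c).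
Proof. by apply: continuous_loc_integrable => t; exact: cvg_cst. Qed.

Lemma loc_integrableM f g :
  measurable_fun setT g ->
  (forall x y, exists C, forall t, t \in `[x, y] -> `|g t| <= C) ->
  loc_integrable f -> loc_integrable (fun t => g t * f t).
Proof.
move=> mg bg lf; apply: (@loc_integrable_dom f) => //.
  move=> x y; apply: measurable_funM; first exact: measurable_funS mg.
  exact: loc_integrable_measurable.
move=> x y; have [C gC] := bg x y; exists C => t /gC tC.
by rewrite normrM ler_wpM2r.
Qed.

Lemma loc_integrable_expM (b : R) f : 0 <= b -> loc_integrable f ->
  loc_integrable (fun t => expR (b * t) * f t).
Proof.
move=> b0; apply: loc_integrableM.
  apply: measurableT_comp => //; exact: measurable_funM.
move=> x y; exists (expR (b * y)) => t; rewrite in_itv/= => /andP[_ ty].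
by rewrite ger0_norm ?expR_ge0// ler_expR ler_wpM2l.
Qed.

Lemma loc_integrable_if (i : interval R) f g :
  loc_integrable f -> loc_integrable g ->
  loc_integrable (fun t => if t \in i then f t else g t).
Proof.
move=> lf lg.
have lr (h : R -> R) A : measurable A -> loc_integrable h ->
    loc_integrable (h \_ A).
  move=> mA lh x y; rewrite -restrict_EFin; apply/integrable_restrict => //.
  by apply: integrableS (lh x y) => //; exact: measurableI.
have -> : (fun t => if t \in i then f t else g t) =
    (fun t => (f \_ [set` i]) t + (g \_ (~` [set` i])) t).
  apply/funext => t; rewrite !patchE.
  have [ti|ti] := boolP (t \in i).
    rewrite mem_set// memNset ?addr0//; exact.
  by rewrite memNset ?mem_set ?add0r//; exact/negP.
by apply: loc_integrableD; apply: lr => //; exact: measurableC.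
Qed.

Lemma integxx f x : integ f x x = 0.
Proof. by rewrite /integ set_itv1 Rintegral_set1. Qed.

Lemma integ_add f x y z : loc_integrable f -> x <= y <= z ->
  integ f x z = integ f x y + integ f y z.
Proof.
move=> lf /andP[xy yz].
have := @Rintegral_itvB _ f (BLeft x) (BRight z) y (lf x z) xy yz.
rewrite Rintegral_itv_obnd_cbnd; last first.
  by apply: integrableS (lf y z) => //; exact: subset_itv_oc_cc.
by rewrite -/(integ f x z) -/(integ f x y) -/(integ f y z); lra.
Qed.

Lemma integD f g x y : loc_integrable f -> loc_integrable g ->
  integ (fun t => f t + g t) x y = integ f x y + integ g x y.
Proof. by move=> lf lg; rewrite /integ RintegralD. Qed.

Lemma integB f g x y : loc_integrable f -> loc_integrable g ->
  integ (fun t => f t - g t) x y = integ f x y - integ g x y.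
Proof. by move=> lf lg; rewrite /integ RintegralB. Qed.

Lemma integZ c f x y : loc_integrable f ->
  integ (fun t => c * f t) x y = c * integ f x y.
Proof. by move=> lf; rewrite /integ RintegralZl. Qed.

Lemma integ_cst c x y : x <= y -> integ (fun=> c) x y = c * (y - x).
Proof.
move=> xy; rewrite /integ Rintegral_cst//= lebesgue_measure_itv/= lte_fin.
case: ltP => [_//|yx]; have -> : x = y by lra.
by rewrite subrr.
Qed.

Lemma eq_integ f g x y : (forall t, x <= t <= y -> f t = g t) ->
  integ f x y = integ g x y.
Proof.
by move=> fg; apply: eq_Rintegral => t; rewrite inE/= in_itv/=; exact: fg.
Qed.

Lemma le_integ f g x y : loc_integrable f -> loc_integrable g ->
  (forall t, x <= t <= y -> f t <= g t) -> integ f x y <= integ g x y.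
Proof.
by move=> lf lg fg; apply: le_Rintegral.
Qed.

Lemma integ_oo f x y : loc_integrable f ->
  integ f x y = \int[mu]_(t in `]x, y[) f t.
Proof.
move=> lf; rewrite /integ -Rintegral_itv_bndo_bndc; last first.
  by apply: integrableS (lf x y) => //; exact: subset_itv_co_cc.
rewrite -Rintegral_itv_obnd_cbnd//.
by apply: integrableS (lf x y) => //; exact: subset_itv_oo_cc.
Qed.

(** Endpoints carry no mass. Spliced policies have arbitrary values at the splice points, so they
    are compared on open intervals only. *)
Lemma eq_integ_oo f g x y : loc_integrable f -> loc_integrable g ->
  (forall t, x < t < y -> f t = g t) -> integ f x y = integ g x y.
Proof.
move=> lf lg fg; rewrite !integ_oo//; apply: eq_Rintegral => t.
by rewrite inE/= in_itv/=; exact: fg.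
Qed.

Lemma le_integ_oo f g x y : loc_integrable f -> loc_integrable g ->
  (forall t, x < t < y -> f t <= g t) -> integ f x y <= integ g x y.
Proof.
move=> lf lg fg; rewrite !integ_oo//; apply: le_Rintegral => //.
- by apply: integrableS (lf x y) => //; exact: subset_itv_oo_cc.
- by apply: integrableS (lg x y) => //; exact: subset_itv_oo_cc.
Qed.

Lemma integ_ge0 f x y : (forall t, x <= t <= y -> 0 <= f t) -> 0 <= integ f x y.
Proof.
by move=> f0; apply: Rintegral_ge0 => t/=; rewrite in_itv/=; exact: f0.
Qed.

Lemma ae_eq_integ f g x y : loc_integrable f -> loc_integrable g ->
  f = g %[ae mu in `[x, y]%classic] -> integ f x y = integ g x y.
Proof.
move=> lf lg fg; congr fine; apply: ae_eq_integral => //.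
- exact: (measurable_int mu (lf x y)).
- exact: (measurable_int mu (lg x y)).
- exact: ae_eq_comp fg.
Qed.

Lemma integ_eq0_ae f x y : loc_integrable f ->
  (forall t, x <= t <= y -> 0 <= f t) -> integ f x y <= 0 ->
  f = cst 0 %[ae mu in `[x, y]%classic].
Proof.
move=> lf f0 If0.
have mf : measurable_fun `[x, y] (EFin \o f).
  exact: (measurable_int mu (lf x y)).
have fin : (\int[mu]_(t in `[x, y]) (f t)%:E \is a fin_num)%E.
  exact: (integrable_fin_num _ (lf x y)).
have I0 : (\int[mu]_(t in `[x, y]) `|(EFin \o f) t| = 0)%E.
  transitivity (\int[mu]_(t in `[x, y]) (f t)%:E)%E.
    apply: eq_integral => t; rewrite inE/= in_itv/= => /f0 ft.
    by rewrite ger0_norm.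
  rewrite -(fineK fin) -[fine _]/(integ f x y).
  by congr EFin; apply/eqP; rewrite eq_le If0 integ_ge0.
have /(ae_eq_integral_abs mu (measurable_itv _) mf) := I0.
by apply: filterS => t /[apply] -[].
Qed.

Lemma continuous_integ f x y : x <= y -> loc_integrable f ->
  {within `[x, y], continuous (integ f x)}.
Proof. by move=> xy lf; exact: parameterized_integral_continuous. Qed.

Lemma loc_integrable_norm f : loc_integrable f ->
  loc_integrable (fun t => `|f t|).
Proof.
move=> lf; apply: (@loc_integrable_dom f) => //.
  move=> x y; apply: measurableT_comp => //; exact: loc_integrable_measurable.
by move=> x y; exists 1 => t _; rewrite normr_id mul1r.
Qed.

(** * Exponentially weighted integrals *)

Lemma continuous_expRM b : continuous (fun t : R => expR (b * t)).
Proof.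
move=> t; apply: continuous_comp; last exact: continuous_expR.
by apply: cvgM; [exact: cvg_cst|exact: cvg_id].
Qed.

Lemma loc_integrable_expR b : loc_integrable (fun t => expR (b * t)).
Proof. exact: continuous_loc_integrable (@continuous_expRM b). Qed.

Lemma integ_expR b x y : b != 0 -> x <= y ->
  integ (fun t => expR (b * t)) x y = (expR (b * y) - expR (b * x)) / b.
Proof.
move=> b0; rewrite le_eqVlt => /predU1P[->|xy].
  by rewrite integxx subrr mul0r.
pose F t := expR (b * t) / b.
have dF t : is_derive t 1 F (expR (b * t)).
  have dM : is_derive t (1 : R) ( *%R b) b.
    have d := is_deriveZ b (is_derive_id t (1 : R)).
    by apply: is_derive_eq d _; exact: mulr1.
  have d := is_deriveZ b^-1 (is_derive1_comp (is_derive_expR (b * t)) dM).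
  have -> : F = b^-1 \*: (expR \o ( *%R b)).
    by apply/funext => r; rewrite /F mulrC.
  by apply: is_derive_eq d _; rewrite /GRing.scale/=; field.
rewrite /integ /Rintegral (@continuous_FTC2 _ _ F)//=.
- rewrite /F; ring.
- by apply: continuous_subspaceT; exact: continuous_expRM.
- split => //.
  + apply: cvg_at_right_filter.
    by apply: differentiable_continuous; apply/derivable1_diffP.
  + apply: cvg_at_left_filter.
    by apply: differentiable_continuous; apply/derivable1_diffP.
- by move=> t _; rewrite derive1E; exact: derive_val.
Qed.

(** The Lipschitz constant depends only on the right end [u], so one constant serves all cells of a
    subdivision of [s, u]. *)
Lemma expRM_le b x y u : 0 <= b -> x <= y <= u ->
  expR (b * y) - expR (b * x) <= b * expR (b * u) * (y - x).
Proof.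
move=> b0 /andP[xy yu].
have -> : expR (b * x) = expR (b * y) * expR (- (b * (y - x))).
  by rewrite -expRD; congr expR; ring.
have h1 := expR_ge1Dx (- (b * (y - x))).
have h2 : expR (b * y) <= expR (b * u) by rewrite ler_expR ler_wpM2l.
have h3 : 0 <= b * (y - x) by rewrite mulr_ge0// subr_ge0.
have h4 := expR_ge0 (b * y).
apply: (@le_trans _ _ (expR (b * y) * (b * (y - x)))).
  by nra.
by rewrite mulrC [leRHS]mulrAC ler_wpM2l.
Qed.

(* Integration by parts would give
   [int_s^u e^(b t) p t = - b int_s^u e^(b t) (int_s^t p)] ; here it is replaced
   by a summation by parts along uniform subdivisions of [s, u]. *)
Lemma integ_expM_ge0 b p s u : 0 <= b -> s <= u -> loc_integrable p ->
  (forall t, s <= t <= u -> integ p s t <= 0) -> integ p s u = 0 ->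
  0 <= integ (fun t => expR (b * t) * p t) s u.
Proof.
move=> b0 su lp H0 Hu.
have lep := loc_integrable_expM b0 lp.
have lnp := loc_integrable_norm lp.
pose X t := integ (fun t => expR (b * t) * p t) s t.
pose H t := integ p s t.
pose V t := integ (fun t => `|p t|) s t.
pose C := b * expR (b * u).
(* One cell of the summation by parts. As H x <= 0, raising its factor from e^(b x) to e^(b y) only
   lowers the left side; on the cell, e^(b t) is replaced by e^(b y) with an error of at most C d
   times the integral of |p|. *)
have step d x y : s <= x -> x <= y <= u -> y - x = d ->
    expR (b * x) * H x - C * d * V x <= X x ->
    expR (b * y) * H y - C * d * V y <= X y.
  move=> sx /andP[xy yu] yxd Xx.
  have sxy : s <= x <= y by rewrite sx xy.
  rewrite /X (integ_add lep sxy) -/(X x).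
  have EH : H y = H x + integ p x y by rewrite /H (integ_add lp sxy).
  have EV : V y = V x + integ (fun t => `|p t|) x y.
    by rewrite /V (integ_add lnp sxy).
  have : x <= y <= u by rewrite xy.
  move=> /(expRM_le b0); rewrite yxd -/C => expxy.
  have exy : expR (b * x) <= expR (b * y) by rewrite ler_expR ler_wpM2l.
  have le1 : expR (b * y) * integ p x y - C * d * integ (fun t => `|p t|) x y
     <= integ (fun t => expR (b * t) * p t) x y.
    rewrite -!integZ// -integB; [|exact: loc_integrableZ..].
    apply: le_integ => //.
      by apply: loc_integrableB; exact: loc_integrableZ.
    move=> t /andP[xt ty].
    have e1 : expR (b * x) <= expR (b * t) by rewrite ler_expR ler_wpM2l.
    have e2 : expR (b * t) <= expR (b * y) by rewrite ler_expR ler_wpM2l.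
    have := ler_norm (p t); have := normr_ge0 (p t); nra.
  have Hx : H x <= 0 by apply: H0; rewrite sx (le_trans xy).
  rewrite EH EV.
  nra.
(* H vanishes at both ends, so only the accumulated error remains, and it is of order 1 / n. *)
have main n : (0 < n)%N -> - (C * ((u - s) / n%:R) * V u) <= X u.
  move=> n0; set d := (u - s) / n%:R.
  have n0' : n%:R != 0 :> R by rewrite pnatr_eq0 -lt0n.
  have d0 : 0 <= d by rewrite divr_ge0// subr_ge0.
  have dn : n%:R * d = u - s by rewrite /d; field.
  have ind k : (k <= n)%N ->
     expR (b * (s + k%:R * d)) * H (s + k%:R * d) - C * d * V (s + k%:R * d)
       <= X (s + k%:R * d).
    elim: k => [_|k IH kn].
      by rewrite mul0r addr0 /H /V /X !integxx; lra.
    have kn' : k.+1%:R * d <= n%:R * d by rewrite ler_wpM2r// ler_nat.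
    apply: (step d (s + k%:R * d)) (IH (ltnW kn)).
    - by rewrite lerDl mulr_ge0.
    - rewrite lerD2l ler_wpM2r ?ler_nat//=; lra.
    - by rewrite -natr1; ring.
  have := ind n (leqnn n).
  by rewrite dn subrKC /H Hu mulr0 sub0r.
rewrite leNgt; apply/negP => Xu; rewrite -/(X u) in Xu.
pose K := C * (u - s) * V u.
pose n := (Num.bound (`|K| / - X u)).+1.
have := main n isT.
have n0 : 0 < n%:R :> R by rewrite ltr0n.
have -> : C * ((u - s) / n%:R) * V u = K / n%:R.
  by rewrite /K; field; rewrite gt_eqF.
apply/negP; rewrite -ltNge ltrNr ltr_pdivrMr//.
have Xu' : 0 < - X u by rewrite oppr_gt0.
have : `|K| / - X u < n%:R.
  apply: lt_le_trans (archi_boundP _) _; first by rewrite divr_ge0// ltW.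
  by rewrite ler_nat.
rewrite ltr_pdivrMr// mulrC => /(le_lt_trans _); apply; exact: ler_norm.
Qed.

(** * Zeros of continuous functions *)

(** The supremum of the zeros in [x, z] works. A nonnegative value after it, or a positive value at
    it, would produce a later zero by the intermediate value theorem; a negative value at it would
    persist nearby, where zeros accumulate. *)
Lemma last_zero_before f x z : x <= z -> {within `[x, z], continuous f} ->
  f x = 0 -> f z < 0 ->
  exists s, [/\ x <= s < z, f s = 0 & forall t, s < t <= z -> f t < 0].
Proof.
move=> xz cf fx fz.
pose S := [set t | x <= t <= z /\ f t = 0].
have Sx : S x by split; rewrite ?lexx.
have Sub : ubound S z by move=> t [/andP[]].
have hs : has_sup S by split; [exists x|exists z].
have supz : sup S <= z by apply: ge_sup => //; exists x.
have xsup : x <= sup S by apply: sup_upper_bound.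
have neg t : sup S < t <= z -> f t < 0.
  move=> /andP[st tz]; rewrite ltNge; apply/negP => ft.
  have [||c] := @IVT _ f t z 0 tz.
  - apply: continuous_subspaceW cf; apply: subset_itvScc => //.
    by rewrite bnd_simp; rewrite (le_trans xsup)// ltW.
  - by rewrite ge_min le_max (ltW fz) ft orbT.
  rewrite in_itv/= => /andP[tc cz] fc.
  have : c <= sup S.
    apply: sup_upper_bound => //; split => //.
    by rewrite cz andbT (le_trans xsup)// (le_trans (ltW st)).
  lra.
have xzS : x <= sup S <= z by rewrite xsup.
have f0 : 0 <= f (sup S).
  rewrite leNgt; apply/negP => fS.
  have /subspace_continuousP/(_ (sup S)) := cf.
  rewrite /= in_itv/= => /(_ xzS)/cvgr_lt/(_ 0 fS).
  rewrite /prop_near1/= /within/= => /nbhs_ballP[e/= e0 He].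
  have [t [txz ft] te] := sup_adherent e0 hs.
  have tS : t <= sup S by apply: sup_upper_bound.
  have : f t < 0.
    have := He t; rewrite /ball/= in_itv/=; apply => //.
    by rewrite ger0_norm ?subr_ge0//; lra.
  by rewrite ft ltxx.
have Sz : sup S < z.
  by rewrite lt_neqAle supz andbT; apply/eqP => E; move: f0; rewrite E; lra.
have f0' : f (sup S) = 0.
  apply/eqP; rewrite eq_le f0 andbT leNgt; apply/negP => fS.
  have [||c] := @IVT _ f (sup S) z 0 supz.
  - apply: continuous_subspaceW cf; apply: subset_itvScc => //.
  - by rewrite ge_min le_max (ltW fz) f0 orbT.
  rewrite in_itv/= => /andP[Sc cz] fc.
  have : c <= sup S.
    by apply: sup_upper_bound => //; split => //; rewrite cz andbT (le_trans xsup).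
  move=> cS; have E : c = sup S by apply/eqP; rewrite eq_le cS.
  by move: fS; rewrite -E fc ltxx.
by exists (sup S); split => //; rewrite xsup.
Qed.

Lemma first_zero_after f z y : z <= y -> {within `[z, y], continuous f} ->
  f y = 0 -> f z < 0 ->
  exists u, [/\ z < u <= y, f u = 0 & forall t, z <= t < u -> f t < 0].
Proof.
move=> zy cf fy fz.
have [||||s [sb fs neg]] := @last_zero_before (fun t => f (- t)) (- y) (- z).
- by rewrite lerN2.
- apply/subspace_continuousP => t /=; rewrite in_itv/= => tyz.
  have /subspace_continuousP/(_ (- t)) := cf.
  rewrite /= in_itv/= => /(_ _)/cvgrPdist_lt H.
  apply/cvgrPdist_lt => e e0.
  have {}H := H _ e e0.
  have /H : z <= - t <= y by lra.
  rewrite /prop_near1/= /within/= => /nbhs_ballP[d/= d0 He].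
  apply/nbhs_ballP; exists d => //= r tr ryz.
  apply: He => /=; last by move: ryz; rewrite /= !in_itv/=; lra.
  by move: tr; rewrite /ball/= (_ : - t - - r = - (t - r)) ?normrN//; ring.
- by rewrite opprK.
- by rewrite opprK.
exists (- s); split => // [|t tb]; first by lra.
by rewrite -(opprK t); apply: neg; lra.
Qed.

(** * Almost everywhere differentiation and slopes of concave functions *)

Lemma ae_exists_itv (p : R -> Prop) x y : {ae mu, forall t, p t} -> x < y ->
  exists2 t, x < t < y & p t.
Proof.
move=> [N [mN N0 pN]] xy; apply: contrapT => np.
have sub : `]x, y[ `<=` N.
  move=> t /=; rewrite in_itv/= => xty; apply: pN => pt.
  by apply: np; exists t.
have : (mu `]x, y[%classic <= mu N)%E.
  by apply: le_measure => //; rewrite inE.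
rewrite N0 lebesgue_measure_itv/= lte_fin xy -EFinB lee_fin; lra.
Qed.

Lemma loc_integrable_locally P : loc_integrable P -> locally_integrable setT P.
Proof.
move=> lP; split; [exact: loc_integrable_measurable|exact: openT|].
move=> K _ cK.
have [M [Mr KM]] := compact_bounded cK.
have sub : K `<=` `[- (M + 1), M + 1].
  move=> t Kt /=; rewrite in_itv/= -ler_norml.
  by apply: (KM (M + 1)) => //; rewrite ltrDl.
have mK : measurable K by exact: compact_measurable.
have /integrableP[] : mu.-integrable K (EFin \o P).
  by apply: integrableS (lP (- (M + 1)) (M + 1)).
by [].
Qed.

Lemma ae_derive_integ P : loc_integrable P ->
  {ae mu, forall t, 0 < t ->
     derivable (integ P 0) t 1 /\ derive1 (integ P 0) t = P t}.
Proof.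
move=> lP; have := @FTC1 R P (BLeft 0) (lP 0) (loc_integrable_locally lP).
apply: filterS; first exact: (ae_filter_ringOfSetsType mu).
by move=> t H t0; apply: H; rewrite /= ?bnd_simp ?lte_fin.
Qed.

(** The factor [e] selects the side: e = 1 and e = -1 give the right and the left difference
    quotient. *)
Lemma derive1_slope F s e d eps : derivable F s 1 -> e != 0 -> 0 < d -> 0 < eps ->
  exists2 h, 0 < h < d & `|(F (s + e * h) - F s) / (e * h) - derive1 F s| < eps.
Proof.
move=> dF e0 d0 eps0.
have : h^-1 *: (F (h *: 1 + s) - F s) @[h --> 0^'] --> derive1 F s.
  by rewrite derive1E; exact: dF.
move=> /cvgrPdist_lt/(_ eps eps0); rewrite /prop_near1/= => /nbhs_ballP[r/= r0 H].
have en : 0 < `|e| by rewrite normr_gt0.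
pose h := Num.min (d / 2) (r / (2 * `|e|)).
have h0 : 0 < h by rewrite lt_min !divr_gt0// mulr_gt0.
exists h.
  by rewrite h0 gt_min; apply/orP; left; lra.
have hr : `|e| * h < r.
  have : h <= r / (2 * `|e|) by rewrite ge_min lexx orbT.
  rewrite ler_pdivlMr ?mulr_gt0//; nra.
have := H (e * h).
rewrite /ball/= sub0r normrN normrM (gtr0_norm h0) => /(_ hr).
have eh : e * h != 0 by rewrite mulf_neq0// gt_eqF.
move=> /(_ eh).
by rewrite distrC /GRing.scale/= mulr1 [e * h + s]addrC [_^-1 * _]mulrC.
Qed.

(** Both derivatives are compared with the slope of the chord over [s, t]; the graph has to lie
    above this one chord only. *)
Lemma concave_derive1_nonincreasing F s t : s < t ->
  derivable F s 1 -> derivable F t 1 ->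
  (forall z, s <= z <= t -> F s * (t - z) + F t * (z - s) <= F z * (t - s)) ->
  derive1 F t <= derive1 F s.
Proof.
move=> st ds dt cF; have ts0 : 0 < t - s by rewrite subr_gt0.
pose sg := (F t - F s) / (t - s).
have sgE : F t - F s = sg * (t - s) by rewrite /sg divfK// gt_eqF.
apply: (@le_trans _ _ sg).
  rewrite leNgt; apply/negP; rewrite -subr_gt0 => lt.
  have N1 : -1 != 0 :> R by rewrite oppr_eq0 oner_eq0.
  have [h /andP[h0 hd]] := derive1_slope dt N1 ts0 lt.
  rewrite !mulN1r; set Fh := F (t - h) => hh.
  have : F t - Fh <= sg * h.
    have : s <= t - h <= t by lra.
    move=> /cF; rewrite -/Fh => H; rewrite -(ler_pM2r ts0); move: H.
    by rewrite (_ : F s = F t - sg * (t - s)); [lra|rewrite -sgE; ring].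
  rewrite -ler_pdivrMr//.
  move: hh; rewrite invrN mulrN -mulNr opprB ltr_norml; lra.
rewrite leNgt; apply/negP; rewrite -subr_gt0 => lt.
have [h /andP[h0 hd]] := derive1_slope ds (oner_neq0 _) ts0 lt.
rewrite !mul1r; set Fh := F (s + h) => hh.
have : sg * h <= Fh - F s.
  have : s <= s + h <= t by lra.
  move=> /cF; rewrite -/Fh => H; rewrite -(ler_pM2r ts0); move: H.
  by rewrite (_ : F t = F s + sg * (t - s)); [lra|rewrite -sgE; ring].
rewrite -ler_pdivlMr//.
move: hh; rewrite ltr_norml; lra.
Qed.

Lemma ae_neq (c : R) : {ae mu, forall t, t != c}.
Proof.
exists [set c]; split => //; first exact: lebesgue_measure_set1.
by move=> t /= /negP; rewrite negbK => /eqP.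
Qed.

End RealAnalysis.

(** * Feasible and optimal policies *)

Section Policies.
Context {R : realType} (D E a b Te Tc T0 : R).
Context (D_gt0 : 0 < D) (a_gt0 : 0 < a) (b_gt0 : 0 < b).
Implicit Types (P Q : R -> R) (r s t u : R).

Notation mu := (@lebesgue_measure R).
Local Notation temp := (temperature a b Te T0).
Local Notation opt := (optimal D E a b Te Tc T0).

Definition critical_power : R := (Tc - Te) * b / a.

(** For locally integrable P and t >= 0, e^(b t) (Tc - T(t)) = Tc - T0 - a [excess_heat P t].
    Subtracting the critical power absorbs the cooling term, so the cap becomes a bound with
    constant right-hand side, and the heat rises or falls with the sign of P - pc. *)
Definition excess_heat P t : R :=
  integ (fun tau => expR (b * tau) * (P tau - critical_power)) 0 t.

Local Notation pc := critical_power.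
Local Notation heat := excess_heat.
Local Notation weight P := (fun tau => expR (b * tau) * (P tau - pc)).

(** Conditions on the whole line free every integral of side conditions on its bounds; an optimal
    policy meets them after truncation to 0 outside [0, D]. *)
Definition admissible P : Prop := loc_integrable P /\ forall t, 0 <= P t.

Lemma loc_integrable_excess P : loc_integrable P ->
  loc_integrable (fun tau => expR (b * tau) * (P tau - critical_power)).
Proof.
move=> lP; apply: loc_integrable_expM; first exact: ltW.
by apply: loc_integrableB => //; exact: loc_integrable_cst.
Qed.

Lemma temperatureE P t : loc_integrable P -> 0 <= t ->
  temperature a b Te T0 P t =
  Tc - expR (- b * t) * (Tc - T0 - a * excess_heat P t).
Proof.
move=> lP t0; rewrite /temperature -/(integ _ 0 t).
have leP := loc_integrable_expM (ltW b_gt0) lP.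
have -> : integ (fun tau => a * expR (b * tau) * P tau) 0 t =
    a * integ (fun tau => expR (b * tau) * P tau) 0 t.
  by rewrite -integZ//; apply: eq_integ => s _; rewrite mulrA.
have -> : excess_heat P t = integ (fun tau => expR (b * tau) * P tau) 0 t -
    critical_power * ((expR (b * t) - 1) / b).
  rewrite -[in X in _ - X](@expR0 R) -[in expR 0](mulr0 b) -integ_expR ?gt_eqF//.
  have le := @loc_integrable_expR R b.
  rewrite -integZ// -integB//; last exact: loc_integrableZ.
  by apply: eq_integ => s _; ring.
have e1 : expR (- b * t) * expR (b * t) = 1.
  by rewrite -expRD mulNr addNr expR0.
move: e1; set em := expR (- b * t); set ep := expR (b * t) => e1.
set I := integ _ _ _.
have -> : a * (I - critical_power * ((ep - 1) / b)) =
   a * I - (Tc - Te) * (ep - 1).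
  by rewrite /critical_power; field; rewrite !gt_eqF.
have -> : em * (Tc - T0 - (a * I - (Tc - Te) * (ep - 1))) =
  em * (Te - T0 - a * I) + (Tc - Te) * (em * ep) by ring.
by rewrite e1; ring.
Qed.

Lemma temperature_le P t : loc_integrable P -> 0 <= t ->
  (temperature a b Te T0 P t <= Tc) = (a * excess_heat P t <= Tc - T0).
Proof.
move=> lP t0; rewrite temperatureE// gerBl pmulr_rge0 ?expR_gt0//.
by rewrite subr_ge0.
Qed.

Lemma energyE P : admissible P -> energy D P = (integ P 0 D)%:E.
Proof.
move=> [lP P0]; rewrite /energy /integ /Rintegral fineK//.
by apply: (integrable_fin_num _ (lP 0 D)).
Qed.

Lemma feasibleP P : admissible P ->
  feasible D E a b Te Tc T0 P <->
  integ P 0 D <= E /\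
  forall t, 0 <= t <= D -> a * excess_heat P t <= Tc - T0.
Proof.
move=> aP; have [lP P0] := aP; rewrite /feasible energyE// lee_fin.
split=> [[_ Tle Ele]|[Ele Hle]]; split => //.
- move=> t /andP[t0 tD]; rewrite -temperature_le//.
  by apply: Tle; rewrite in_itv/= t0.
- by split => //; exact: loc_integrable_measurable.
- move=> t; rewrite in_itv/= => /andP[t0 tD].
  by rewrite temperature_le//; apply: Hle; rewrite t0.
Qed.

Lemma loc_integrable_ln1D P : admissible P ->
  loc_integrable (fun t => ln (1 + P t)).
Proof.
move=> [lP P0]; apply: (@loc_integrable_dom _ P) => //.
  move=> x y; apply: measurableT_comp => //.
  by apply: measurable_funD => //; exact: loc_integrable_measurable.
move=> x y; exists 1 => t _; have Pt := P0 t.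
rewrite mul1r !ger0_norm//; first by apply: le_ln1Dx; lra.
by apply: ln_ge0; lra.
Qed.

Lemma throughputE P : admissible P -> throughput D P =
  (2^-1 / ln 2 * integ (fun t => ln (1 + P t)) 0 D)%:E.
Proof.
move=> aP; have lln := loc_integrable_ln1D aP.
rewrite /throughput -integZ// /integ /Rintegral fineK.
  by apply: eq_integral => t _; rewrite /log2; congr EFin; ring.
by apply: (integrable_fin_num _ (loc_integrableZ _ lln 0 D)).
Qed.

Lemma le_throughput P Q : admissible P -> admissible Q ->
  (throughput D P <= throughput D Q)%E =
  (integ (fun t => ln (1 + P t)) 0 D <= integ (fun t => ln (1 + Q t)) 0 D).
Proof.
move=> aP aQ; rewrite !throughputE// lee_fin ler_pM2l//.
by rewrite divr_gt0// ln_gt0//; lra.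
Qed.

Lemma ae_eq_in_itv P Q x y x' y' : x' <= x -> y <= y' ->
  P = Q %[ae mu in `[x', y']%classic] -> P = Q %[ae mu in `[x, y]%classic].
Proof.
move=> xx yy; apply: ae_eq_subset; apply: subset_itvScc => //.
Qed.

Lemma excess_heat_ae_eq P Q t : loc_integrable P -> loc_integrable Q ->
  P = Q %[ae mu in `[0, D]%classic] -> t <= D ->
  excess_heat P t = excess_heat Q t.
Proof.
move=> lP lQ PQ tD; apply: ae_eq_integ; [exact: loc_integrable_excess..|].
have := ae_eq_in_itv (lexx 0) tD PQ.
apply: filterS; first exact: (ae_filter_ringOfSetsType mu).
by move=> s /[apply] ->.
Qed.

Lemma optimal_ae_eq P Q : admissible P -> admissible Q ->
  P = Q %[ae mu in `[0, D]%classic] ->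
  optimal D E a b Te Tc T0 P -> optimal D E a b Te Tc T0 Q.
Proof.
move=> aP aQ PQ [/(feasibleP aP)[EP HP] maxP].
have [[lP _] [lQ _]] := (aP, aQ).
split.
  apply/(feasibleP aQ); split; first by rewrite -(ae_eq_integ lP lQ PQ).
  move=> t t0D; rewrite -(excess_heat_ae_eq lP lQ PQ); first exact: HP.
  by case/andP: t0D.
move=> P' /maxP; congr (_ <= _)%E; rewrite !throughputE//; congr (_ * _)%:E.
apply: ae_eq_integ; [exact: loc_integrable_ln1D..|].
move: PQ; apply: filterS; first exact: (ae_filter_ringOfSetsType mu).
by move=> s /[apply] ->.
Qed.

(** Integrability on [0, D] comes from the energy budget, since P is nonnegative there. *)
Lemma optimal_admissible P : optimal D E a b Te Tc T0 P ->
  exists P', [/\ admissible P', optimal D E a b Te Tc T0 P' &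
    P' = P %[ae mu in `[0, D]%classic]].
Proof.
move=> [[[mP P0] TP EP] maxP].
have PE t : t \in `[0, D] -> (P \_ `[0, D]) t = P t.
  by move=> tD; rewrite patchE mem_set.
have iP : mu.-integrable `[0, D] (EFin \o P).
  apply/integrableP; split; first exact/measurable_EFinP.
  apply: (@le_lt_trans _ _ E%:E); last by rewrite ltry.
  apply: le_trans EP; rewrite le_eqVlt; apply/orP; left; apply/eqP.
  by apply: eq_integral => t; rewrite inE/= => /P0 Pt; rewrite ger0_norm.
have aP : admissible (P \_ `[0, D]).
  split; last first.
    by move=> t; rewrite patchE; case: ifPn => // /set_mem; exact: P0.
  move=> x y; rewrite -restrict_EFin; apply/integrable_restrict => //.
  by apply: integrableS iP => //; exact: measurableI.
exists (P \_ `[0, D]); split => //; last first.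
  by apply: aeW => t /PE.
split.
  split; [split|..].
  - exact: loc_integrable_measurable aP.1 _.
  - by move=> t tD; rewrite PE//; exact: P0.
  - move=> t tD; rewrite [X in X <= _](_ : _ = temperature a b Te T0 P t).
      exact: TP.
    rewrite /temperature; congr (_ + _ * (_ + _)).
    apply: eq_Rintegral => s; rewrite inE/= in_itv/= => /andP[s0 st].
    rewrite PE// in_itv/= s0 (le_trans st)//.
    by move: tD; rewrite in_itv/= => /andP[].
  - apply: le_trans EP; rewrite le_eqVlt; apply/orP; left; apply/eqP.
    by apply: eq_integral => s; rewrite inE => /PE ->.
move=> P' /maxP; congr (_ <= _)%E; apply: eq_integral => s.
by rewrite inE => /PE ->.
Qed.

(** * First-order optimality and averaging *)

Lemma loc_integrable_gain P P' : admissible P -> admissible P' ->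
  loc_integrable (fun t => (P' t - P t) / (1 + P' t)).
Proof.
move=> [lP P0] [lP' P0'].
apply: (@loc_integrable_dom _ (fun t => P' t - P t)).
- move=> x y.
  have -> : (fun t => (P' t - P t) / (1 + P' t)) =
      (fun t => (P' t - P t) * expR (- ln (1 + P' t))).
    by apply/funext => t; rewrite expRN lnK// posrE; have := P0' t; lra.
  apply: measurable_funM.
    by apply: measurable_funB; exact: loc_integrable_measurable.
  do 3 apply: measurableT_comp => //.
  by apply: measurable_funD => //; exact: loc_integrable_measurable.
- exact: loc_integrableB.
- move=> x y; exists 1 => t _; have := P0' t => Pt.
  rewrite mul1r normrM ler_piMr// normfV invf_le1 ger0_norm; lra.
Qed.

(* Concavity of [ln] bounds the gain of throughput from below by the integral
   of [(P' - P) / (1 + P')], strictly unless the policies agree. *)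
Lemma optimal_first_order P P' : admissible P -> admissible P' ->
  optimal D E a b Te Tc T0 P -> feasible D E a b Te Tc T0 P' ->
  0 <= integ (fun t => (P' t - P t) / (1 + P' t)) 0 D ->
  P' = P %[ae mu in `[0, D]%classic].
Proof.
move=> aP aP' [_ maxP] /maxP; rewrite le_throughput// => lePP' I0.
have [[lP P0] [lP' P0']] := (aP, aP').
have lq := loc_integrable_gain aP aP'.
(* The defect in the tangent inequality of [ln] at P'. With q = (1 + P) / (1 + P') it equals q - 1 -
   ln q, which is nonnegative and vanishes only at q = 1; optimality of P makes its integral
   nonpositive. *)
pose r t := ln (1 + P' t) - ln (1 + P t) - (P' t - P t) / (1 + P' t).
have lr : loc_integrable r.
  apply: loc_integrableB => //.
  by apply: loc_integrableB; exact: loc_integrable_ln1D.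
have key t : 0 <= r t /\ (r t = 0 -> P' t = P t).
  have := P0 t; have := P0' t => p' p.
  have q0 : 0 < (1 + P t) / (1 + P' t) by rewrite divr_gt0//; lra.
  have -> : r t = (1 + P t) / (1 + P' t) - 1 - ln ((1 + P t) / (1 + P' t)).
    by rewrite /r ln_div ?posrE; [field; lra|lra|lra].
  have qE := lnK q0; move: (ln _) qE => l qE.
  rewrite -qE; split; first by have := expR_ge1Dx l; lra.
  have [l0 _|l0] := eqVneq l 0; last by have := expR_gt1Dx l0; lra.
  move: qE; rewrite l0 expR0 => /esym/divr1_eq; lra.
have r0 := integ_eq0_ae lr (fun t _ => (key t).1).
have : integ r 0 D <= 0.
  rewrite /r integB//; last by apply: loc_integrableB; exact: loc_integrable_ln1D.
  rewrite integB; [|exact: loc_integrable_ln1D..]; lra.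
move=> /r0; apply: filterS; first exact: (ae_filter_ringOfSetsType mu).
by move=> t /[apply] /(key t).2.
Qed.

Lemma excess_heat_add P s t : loc_integrable P -> 0 <= s <= t ->
  heat P t = heat P s + integ (weight P) s t.
Proof.
move=> lP st; rewrite /excess_heat (integ_add _ st)//.
exact: loc_integrable_excess.
Qed.

(** The two heat bounds are the feasibility, on [s, u] and on [u, D], of the policy equal to [m] on
    [s, u] and to P elsewhere; before [s] nothing changes. The conclusion is in integrated form and
    so holds at every t. *)
Lemma average_rigid P s u m : admissible P -> opt P ->
  0 <= s < u -> u <= D -> integ P s u = m * (u - s) ->
  (forall t, s <= t <= u ->
    a * (heat P s + (m - pc) * integ (fun tau => expR (b * tau)) s t) <= Tc - T0) ->
  (forall t, u <= t <= D ->
    a * (heat P s + (m - pc) * integ (fun tau => expR (b * tau)) s u +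
      integ (weight P) u t) <= Tc - T0) ->
  forall t, s <= t <= u -> integ P s t = m * (t - s).
Proof.
move=> aP oP /andP[s0 su] uD Pm H1 H2.
have [lP P0] := aP.
have sD : s <= D by lra.
have m0 : 0 <= m.
  by rewrite -(@pmulr_lge0 _ (u - s)) ?subr_gt0// -Pm integ_ge0.
pose P' t := if t \in `[s, u] then m else P t.
have P'E t : s <= t <= u -> P' t = m by rewrite /P' in_itv/= => ->.
have P'1 t : t < s -> P' t = P t.
  by move=> ts; rewrite /P' in_itv/=; case: ifP => //; lra.
have P'2 t : u < t -> P' t = P t.
  by move=> ts; rewrite /P' in_itv/=; case: ifP => //; lra.
have lc := @loc_integrable_cst R.
have lP' : loc_integrable P' by exact: loc_integrable_if.
have aP' : admissible P' by split => // t; rewrite /P'; case: ifP.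
have lw Q : loc_integrable Q -> loc_integrable (weight Q).
  by move=> lQ; exact: loc_integrable_excess.
have le := @loc_integrable_expR R b.
have h1 t : 0 <= t <= s -> heat P' t = heat P t.
  move=> /andP[t0 ts]; apply: eq_integ_oo; [exact: lw..|] => r /andP[r0 rt].
  by rewrite P'1//; lra.
have h2 t : s <= t <= u ->
    heat P' t = heat P s + (m - pc) * integ (fun tau => expR (b * tau)) s t.
  move=> /andP[st tu]; rewrite (@excess_heat_add P' s)//; last by rewrite s0.
  rewrite h1 ?s0 ?lexx//; congr (_ + _); rewrite -integZ//.
  apply: eq_integ => r /andP[sr rt]; rewrite P'E; first exact: mulrC.
  by rewrite sr (le_trans rt).
have h3 t : u <= t -> heat P' t = heat P s +
    (m - pc) * integ (fun tau => expR (b * tau)) s u + integ (weight P) u t.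
  move=> ut; rewrite (@excess_heat_add P' u)//; last by lra.
  rewrite h2 ?lexx ?(ltW su)//; congr (_ + _).
  by apply: eq_integ_oo; [exact: lw..|] => r /andP[ur rt]; rewrite P'2.
have intP' : integ P' 0 D = integ P 0 D.
  rewrite (@integ_add _ P' 0 s D) ?s0// (@integ_add _ P 0 s D) ?s0//.
  congr (_ + _).
    by apply: eq_integ_oo => // r /andP[_ rs]; exact: P'1.
  rewrite (@integ_add _ P' s u D) ?(ltW su)//.
  rewrite (@integ_add _ P s u D) ?(ltW su)//; congr (_ + _).
    by rewrite Pm -integ_cst ?ltW//; apply: eq_integ.
  by apply: eq_integ_oo => // r /andP[ur _]; exact: P'2.
have fP' : feasible D E a b Te Tc T0 P'.
  have [/(feasibleP aP)[EP HP] _] := oP.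
  apply/(feasibleP aP'); split.
    by rewrite intP'.
  move=> t /andP[t0 tD]; have [ts|st] := leP t s.
    by rewrite h1 ?t0// HP// t0.
  have [tu|ut] := leP t u.
    by rewrite h2 ?H1 ?tu ?(ltW st).
  by rewrite h3 ?H2 ?(ltW ut).
(* P' - P vanishes off [s, u], so the denominator may be replaced by 1 + m everywhere; what remains
   is the difference of energies, which is 0. *)
have fo : 0 <= integ (fun t => (P' t - P t) / (1 + P' t)) 0 D.
  have -> : (fun t => (P' t - P t) / (1 + P' t)) =
            (fun t => (1 + m)^-1 * (P' t - P t)).
    apply/funext => t; rewrite mulrC /P'; case: ifP => // _.
    by rewrite subrr !mulr0.
  have ld : loc_integrable (fun t => P' t - P t) by exact: loc_integrableB.
  rewrite integZ// mulr_ge0 ?invr_ge0 ?addr_ge0// integB// subr_ge0.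
  by rewrite intP'.
have PP' := optimal_first_order aP aP' oP fP' fo.
move=> t /andP[st tu].
rewrite -(ae_eq_integ (x := s) (y := t) lP' lP); last first.
  by apply: ae_eq_in_itv PP' => //; lra.
by rewrite -integ_cst//; apply: eq_integ => r /andP[sr rt]; rewrite P'E//; lra.
Qed.

Lemma integ_concave P x z y : admissible P -> opt P ->
  0 <= x -> x <= z <= y -> y <= D -> x < y ->
  integ P 0 x * (y - z) + integ P 0 y * (z - x) <= integ P 0 z * (y - x).
Proof.
move=> aP oP x0 /andP[xz zy] yD xy; have [lP P0] := aP.
have addP s t : 0 <= s <= t -> integ P 0 t = integ P 0 s + integ P s t.
  exact: integ_add.
pose m := integ P x y / (y - x).
have yx0 : 0 < y - x by rewrite subr_gt0.
have mE : integ P x y = m * (y - x) by rewrite /m divfK// gt_eqF.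
have lc := @loc_integrable_cst R.
have lp : loc_integrable (fun t => P t - m) by exact: loc_integrableB.
pose f := integ (fun t => P t - m) x.
have fE t : x <= t -> f t = integ P x t - m * (t - x).
  by move=> xt; rewrite /f integB// integ_cst.
suff fz : 0 <= f z.
  have x0y : 0 <= x <= y by lra.
  rewrite fE// in fz; rewrite (addP x y)// (addP x z) ?x0// mE.
  rewrite -subr_ge0 [leRHS](_ : _ = (y - x) * (integ P x z - m * (z - x))).
    by rewrite mulr_ge0// ltW.
  ring.
rewrite leNgt; apply/negP => fz.
have cf : {within `[x, y], continuous f} by apply/continuous_integ/lp/ltW.
have fx : f x = 0 by rewrite /f integxx.
have fy : f y = 0 by rewrite fE ?ltW// mE subrr.
have cfx : {within `[x, z], continuous f}.
  by apply: continuous_subspaceW cf; exact: subset_itvScc.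
have cfy : {within `[z, y], continuous f}.
  by apply: continuous_subspaceW cf; exact: subset_itvScc.
(* Shrink to the largest interval around [z] on which the cumulative energy is strictly below the
   chord. As f vanishes at [s] and [u], the mean power on [s, u] is again [m]. *)
have [s [/andP[xs sz] fs negs]] := last_zero_before xz cfx fx fz.
have [u [/andP[zu uy] fu negu]] := first_zero_after zy cfy fy fz.
have su : s < u by lra.
have neg t : s <= t <= u -> f t <= 0.
  move=> /andP[st tu].
  have [->|ts] := eqVneq t s; first by rewrite fs.
  have [->|tu'] := eqVneq t u; first by rewrite fu.
  have [tz|zt] := leP t z; apply: ltW.
    by apply: negs; rewrite tz andbT lt_neqAle eq_sym ts.
  by apply: negu; rewrite (ltW zt) lt_neqAle tu'.
have fst t : s <= t -> integ (fun t => P t - m) s t = f t.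
  by move=> st; rewrite /f (@integ_add _ _ x s t) ?xs// -/(f s) fs add0r.
have le := @loc_integrable_expR R b.
have pos : 0 <= integ (fun t => expR (b * t) * (P t - m)) s u.
  apply: integ_expM_ge0 => //; [exact: ltW|exact: ltW| |].
    by move=> t stu; rewrite fst ?neg//; case/andP: stu.
  by rewrite fst ?ltW.
have wE t : s <= t -> integ (weight P) s t =
    integ (fun t => expR (b * t) * (P t - m)) s t +
    (m - pc) * integ (fun t => expR (b * t)) s t.
  move=> st; rewrite -integZ// -integD//; last 2 first.
  - by apply: loc_integrable_expM => //; exact: ltW.
  - exact: loc_integrableZ.
  by apply: eq_integ => r _; ring.
have s0 : 0 <= s by lra.
have [/(feasibleP aP)[EP HP] _] := oP.
have expge s1 t : s1 <= t -> 0 <= integ (fun t => expR (b * t)) s1 t.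
  by move=> _; apply: integ_ge0 => r _; exact: expR_ge0.
have hu : heat P u = heat P s + integ (weight P) s u.
  by apply: excess_heat_add => //; rewrite s0 ltW.
(* Under power [m] the heat is monotone, hence bounded by an end value: the one at [s] if m <= pc,
   and otherwise the one at [u], which [pos] bounds by the actual heat. *)
have H1 t : s <= t <= u -> a * (heat P s +
    (m - pc) * integ (fun tau => expR (b * tau)) s t) <= Tc - T0.
  move=> /andP[st tu].
  have [mpc|pcm] := leP m pc.
    apply: le_trans (HP s _); last by lra.
    rewrite ler_pM2l// gerDl; apply: mulr_le0_ge0; [lra|exact: expge].
  apply: le_trans (HP u _); last by lra.
  rewrite ler_pM2l// hu lerD2l wE ?(ltW su)//.
  have stu : s <= t <= u by rewrite st.
  rewrite (integ_add le stu).
  have : 0 <= (m - pc) * integ (fun tau => expR (b * tau)) t u.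
    by rewrite mulr_ge0 ?expge// subr_ge0 ltW.
  rewrite mulrDr; lra.
have Pm : integ P s u = m * (u - s).
  have := fst u (ltW su); rewrite fu integB// integ_cst ?ltW//; lra.
have := @average_rigid P s u m aP oP _ _ Pm H1 _ z.
rewrite s0 su => /(_ isT); have -> : u <= D by lra.
move=> /(_ isT) H.
(* After [u] both policies add the same heat, so the comparison at [u] persists. *)
have /H : forall t, u <= t <= D -> a * (heat P s +
      (m - pc) * integ (fun tau => expR (b * tau)) s u +
      integ (weight P) u t) <= Tc - T0.
  move=> t /andP[ut tD]; apply: le_trans (HP t _); last by lra.
  rewrite ler_pM2l// (@excess_heat_add P u t)//; last by lra.
  by rewrite lerD2r hu lerD2l wE ?(ltW su)// lerDr.
have szu : s <= z <= u by lra.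
move=> /(_ szu) Pz.
have := fst z (ltW sz); rewrite integB// integ_cst ?ltW// Pz subrr => fz0.
by move: fz; rewrite -fz0 ltxx.
Qed.

(** * Existence of a nonincreasing version *)

(** At these points, almost all of [0, D], the value of P is a slope of the cumulative energy, so
    concavity orders the values themselves. *)
Definition regular_point P t : Prop :=
  [/\ 0 < t < D, derivable (integ P 0) t 1 & derive1 (integ P 0) t = P t].

Lemma regular_point_nonincreasing P s t : admissible P -> opt P ->
  regular_point P s -> regular_point P t -> s <= t -> P t <= P s.
Proof.
move=> aP oP [/andP[s0 sD] ds <-] [/andP[t0 tD] dt <-].
rewrite le_eqVlt => /predU1P[->//|st].
apply: concave_derive1_nonincreasing => // z szt.
exact: (integ_concave aP oP (ltW s0) szt (ltW tD) st).
Qed.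

(* Moving the energy above a high level [M] to [s0, D], after division by
   e^(b D) so that no temperature increases, would raise the throughput. *)
Lemma optimal_bounded P s0 K : admissible P -> opt P -> 0 < s0 < D ->
  (forall t, s0 <= t <= D -> P t <= K) ->
  exists M, {ae mu, forall t, t \in `[0, D] -> P t <= M}.
Proof.
move=> aP oP /andP[s00 s0D] PK; have [lP P0] := aP.
have K0 : 0 <= K by apply: le_trans (P0 s0) (PK s0 _); rewrite lexx ltW.
have [/(feasibleP aP)[EP HP] _] := oP.
have IP0 : 0 <= integ P 0 D by apply: integ_ge0 => t _.
have E0 : 0 <= E by exact: le_trans EP.
have Ds0 : 0 < D - s0 by rewrite subr_gt0.
have q0 : 0 <= E / (D - s0) by rewrite divr_ge0// ltW.
have eD1 : 1 <= expR (b * D) by rewrite -expR0 ler_expR mulr_ge0// ltW.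
(* Cutting at M loses at most 1 / (1 + M) per unit of energy; adding [k] on [s0, D] gains at least 1
   / (1 + K + k) per unit, on e^(- b D) times the energy cut. Since k <= E / (D - s0), this M gives
   e^(b D) (1 + K + k) <= 1 + M. *)
pose M := expR (b * D) * (1 + K + E / (D - s0)).
have KM : K <= M by rewrite /M; nra.
exists M.
pose g t := Num.max (P t - M) 0.
have g0 t : 0 <= g t by rewrite le_max lexx orbT.
have gP t : g t <= P t by rewrite ge_max P0 andbT lerBlDr lerDl (le_trans K0).
have gE t : g t = 0 \/ g t = P t - M /\ M <= P t.
  rewrite /g; have [_|MP] := leP (P t - M) 0; first by left.
  by right; split; [|rewrite -subr_ge0 ltW].
have lg : loc_integrable g.
  apply: (@loc_integrable_dom _ P) => //.
    move=> x y; apply: measurable_maxr => //.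
    by apply: measurable_funB => //; exact: loc_integrable_measurable.
  by move=> x y; exists 1 => t _; rewrite mul1r !ger0_norm.
have gs0 t : s0 <= t <= D -> g t = 0.
  by move=> /PK tK; case: (gE t) => // -[-> MP]; lra.
pose eps := integ g 0 D.
have eps0 : 0 <= eps by apply: integ_ge0.
have epsE : eps <= E by apply: le_trans EP; apply: le_integ.
have eps1 : eps = integ g 0 s0.
  have s0in : 0 <= s0 <= D by rewrite !ltW.
  rewrite /eps (integ_add lg s0in) (_ : integ g s0 D = 0) ?addr0//.
  rewrite (@eq_integ _ _ (fun=> 0)) ?integ_cst ?mul0r//; exact: ltW.
pose k := expR (- (b * D)) * (eps / (D - s0)).
have k0 : 0 <= k by rewrite mulr_ge0 ?expR_ge0// divr_ge0// ltW.
have kE : expR (b * D) * (k * (D - s0)) = eps.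
  rewrite /k expRN; field; rewrite !gt_eqF ?expR_gt0//.
have kE' : k * (D - s0) <= eps.
  have : 0 <= k * (D - s0) by rewrite mulr_ge0// ltW.
  rewrite -kE; nra.
have kq : k <= E / (D - s0).
  by rewrite ler_pdivlMr// (le_trans kE').
pose i t : R := if t \in `[s0, D] then k else 0.
have li : loc_integrable i by apply: loc_integrable_if; exact: loc_integrable_cst.
have i0 t : 0 <= i t by rewrite /i; case: ifP.
pose P' t := P t - g t + i t.
have lP' : loc_integrable P' by apply: loc_integrableD => //; exact: loc_integrableB.
have aP' : admissible P'.
  by split => // t; rewrite addr_ge0// subr_ge0.
have b0 := ltW b_gt0.
have leg := loc_integrable_expM b0 lg.
have lei := loc_integrable_expM b0 li.
have heatP' t : heat P' t = heat P t - integ (fun r => expR (b * r) * g r) 0 t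
   + integ (fun r => expR (b * r) * i r) 0 t.
  rewrite /excess_heat -integB//; last exact: loc_integrable_excess.
  rewrite -integD//; last first.
    by apply: loc_integrableB => //; exact: loc_integrable_excess.
  by apply: eq_integ => r _; rewrite /P'; ring.
have i_lt t : t < s0 -> i t = 0.
  by move=> ts; rewrite /i in_itv/= [s0 <= t]leNgt ts.
have i_ge t : s0 <= t <= D -> i t = k by rewrite /i in_itv/= => ->.
have iI w t : loc_integrable (fun r => w r * i r) -> 0 <= t <= s0 ->
    integ (fun r => w r * i r) 0 t = 0.
  move=> lwi /andP[t0 ts].
  rewrite (@eq_integ_oo _ _ (fun=> 0)) ?integ_cst ?mul0r//.
    exact: loc_integrable_cst.
  by move=> r /andP[_ rt]; rewrite i_lt ?mulr0// (lt_le_trans rt).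
have geg t : 0 <= t -> integ g 0 t <= integ (fun r => expR (b * r) * g r) 0 t.
  move=> t0; apply: le_integ => // r /andP[r0 _].
  by rewrite ler_peMl// -expR0 ler_expR mulr_ge0.
have intD : integ i 0 D = k * (D - s0).
  have s0in : 0 <= s0 <= D by rewrite !ltW.
  rewrite (integ_add li s0in) -integ_cst ?(ltW s0D)//.
  have := iI (fun=> 1) s0; rewrite (_ : (fun r => 1 * i r) = i); last first.
    by apply/funext => r; rewrite mul1r.
  move=> -> //; last by rewrite lexx ltW.
  by rewrite add0r; apply: eq_integ => r; exact: i_ge.
have fP' : feasible D E a b Te Tc T0 P'.
  apply/(feasibleP aP'); split.
    rewrite /P' integD ?integB//; last exact: loc_integrableB.
    by rewrite intD -/eps; lra.
  move=> t /andP[t0 tD]; apply: le_trans (HP t _); last by rewrite t0.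
  rewrite ler_pM2l// heatP'.
  have gt := geg t t0.
  have [ts|st] := leP t s0.
    rewrite iI ?t0// addr0 gerBl; apply: le_trans gt; exact: integ_ge0.
  have s0t : 0 <= s0 <= t by rewrite !ltW.
  have : eps <= integ g 0 t.
    by rewrite eps1 (integ_add lg s0t) lerDl; exact: integ_ge0.
  have : integ (fun r => expR (b * r) * i r) 0 t <= eps.
    rewrite (integ_add lei s0t) iI ?lexx ?(ltW s00)// add0r.
    apply: (@le_trans _ _ (integ (fun=> expR (b * D) * k) s0 t)).
      apply: le_integ => //; first exact: loc_integrable_cst.
      move=> r /andP[sr rt]; rewrite i_ge ?sr ?(le_trans rt)//.
      by rewrite ler_wpM2r// ler_expR ler_wpM2l// (le_trans rt).
    rewrite integ_cst ?(ltW st)// -kE -mulrA ler_wpM2l ?expR_ge0//.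
    by rewrite ler_wpM2l// lerD2r.
  lra.
have M0 : 0 < 1 + M by lra.
have K1 : 0 < 1 + K + k by lra.
have fo : 0 <= integ (fun t => (P' t - P t) / (1 + P' t)) 0 D.
  have lq : loc_integrable (fun t => (P' t - P t) / (1 + P' t)).
    exact: loc_integrable_gain.
  pose low t := (1 + K + k)^-1 * i t - (1 + M)^-1 * g t.
  apply: (@le_trans _ _ (integ low 0 D)); rewrite /low.
    rewrite integB; [|exact: loc_integrableZ..].
    rewrite !integZ// -/eps intD subr_ge0 -kE.
    have kD0 : 0 <= k * (D - s0) by rewrite mulr_ge0// ltW.
    rewrite mulrA ler_wpM2r// mulrC ler_pdivrMr// [leRHS]mulrC ler_pdivlMr//.
    apply: (@le_trans _ _ M); last by rewrite lerDr.
    by rewrite /M ler_wpM2l ?expR_ge0// lerD2l.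
  apply: le_integ => //.
    by apply: loc_integrableB; exact: loc_integrableZ.
  move=> t /andP[t0 tD].
  have P't := aP'.2 t.
  have [ts|st] := ltP t s0.
    rewrite i_lt// mulr0 sub0r /P' (i_lt _ ts) addr0.
    have [->|[gt MP]] := gE t.
      by rewrite mulr0 oppr0 addr0 subrr mul0r.
    rewrite gt (_ : P t - (P t - M) = M); last by ring.
    by rewrite -mulrN opprB mulrC.
  have st' : s0 <= t <= D by rewrite st.
  rewrite gs0// mulr0 subr0 /P' gs0// subr0 i_ge//.
  have -> : P t + k - P t = k by ring.
  have tK := PK t st'; have Pt := P0 t.
  have Ptk : 0 < 1 + (P t + k) by apply: ltr_pwDl => //; exact: addr_ge0.
  rewrite mulrC ler_wpM2l// lef_pV2 ?posrE//.
  by rewrite -addrA lerD2l lerD2r.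
(* Equality of P' and P almost everywhere says that before s0 nothing was cut, that is P <= M. *)
have := optimal_first_order aP aP' oP fP' fo.
apply: filterS; first exact: (ae_filter_ringOfSetsType mu).
move=> t H tD; have := H tD; move: tD; rewrite in_itv/= => /andP[t0 tD].
have [ts|st _] := ltP t s0; last by apply: le_trans KM; apply: PK; rewrite st.
rewrite /P' i_lt// addr0; case: (gE t) => [|[-> _] PE].
  rewrite /g; case: (leP (P t - M) 0); rewrite ?subr_le0// => + /eqP.
  by move=> /gt_eqF ->.
by rewrite -PE subKr.
Qed.

Lemma nonincreasing_representative P : admissible P -> opt P ->
  exists Q, [/\ admissible Q, opt Q, Q = P %[ae mu in `[0, D]%classic] &
    forall s t, s <= t -> Q t <= Q s].
Proof.
move=> aP oP; have [lP P0] := aP.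
have reg : {ae mu, forall t, t \in `[0, D] -> regular_point P t}.
  have H0 := @ae_neq R 0; have HD := ae_neq D; have Hd := ae_derive_integ lP.
  move: Hd; apply: filter_app; first exact: (ae_filter_ringOfSetsType mu).
  move: HD; apply: filter_app; first exact: (ae_filter_ringOfSetsType mu).
  move: H0; apply: filterS; first exact: (ae_filter_ringOfSetsType mu).
  move=> t t0 tD dt; rewrite in_itv/= => /andP[t0' tD'].
  have t0'' : 0 < t by rewrite lt_neqAle eq_sym t0.
  have [dP Pt] := dt t0''.
  by split => //; rewrite t0'' lt_neqAle tD.
have [s0 /andP[s00 s0D] /(_ _)] := ae_exists_itv reg D_gt0.
rewrite in_itv/= !ltW// => /(_ isT) rs0.
(* A change on a null set that turns the almost everywhere bound by P s0 on [s0, D] into the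
   pointwise bound required by [optimal_bounded]. *)
pose P1 t := if t \in `[s0, D] then Num.min (P t) (P s0) else P t.
have P10 t : 0 <= P1 t by rewrite /P1; case: ifP => // _; rewrite le_min !P0.
have lP1 : loc_integrable P1.
  apply: loc_integrable_if => //; apply: (@loc_integrable_dom _ P) => //.
    by move=> x y; apply: measurable_minr => //; exact: loc_integrable_measurable.
  move=> x y; exists 1 => t _; rewrite mul1r !ger0_norm ?le_min ?P0//.
  by rewrite ge_min lexx.
have P1P : P1 = P %[ae mu in `[0, D]%classic].
  move: reg; apply: filterS; first exact: (ae_filter_ringOfSetsType mu).
  move=> t rt tD; rewrite /P1; case: ifP => //; rewrite in_itv/= => /andP[st _].
  apply/min_idPl; apply: (regular_point_nonincreasing aP oP rs0 _ st).
  exact: rt.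
have aP1 : admissible P1 by [].
have PP1 : P = P1 %[ae mu in `[0, D]%classic] by exact: ae_eq_sym.
have oP1 := optimal_ae_eq aP aP1 PP1 oP.
have [||M PM] := optimal_bounded (s0 := s0) (K := P s0) aP1 oP1.
- by rewrite s00.
- by move=> t tD; rewrite /P1 in_itv/= tD ge_min lexx orbT.
pose A t := regular_point P t /\ P t <= M.
have aeA : {ae mu, forall t, t \in `[0, D] -> A t}.
  move: PM; apply: filter_app; first exact: (ae_filter_ringOfSetsType mu).
  move: P1P; apply: filter_app; first exact: (ae_filter_ringOfSetsType mu).
  move: reg; apply: filterS; first exact: (ae_filter_ringOfSetsType mu).
  move=> t rt PE PM tD; split; first exact: rt.
  by rewrite -PE//; exact: PM.
(* [Q] will be the least nonincreasing majorant of P on the good points, finite thanks to [M].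
   Adjoining 0 keeps the set nonempty where no good point lies to the right; in particular Q D =
   0. *)
pose S t := [set x | x = 0 \/ exists s, [/\ A s, t <= s & x = P s]].
have S0 t : S t 0 by left.
pose M' := Num.max M 0.
have SM t : ubound (S t) M'.
  by move=> x [->|[s [[_ sM] _ ->]]]; rewrite le_max ?lexx ?orbT ?sM.
have Shu t : has_ubound (S t) by exists M'.
pose Q t := sup (S t).
have Q0 t : 0 <= Q t by apply: ub_le_sup => //; exact: S0.
have QM t : Q t <= M' by apply: ge_sup => //; exists 0; exact: S0.
have Qni s t : s <= t -> Q t <= Q s.
  move=> st; apply: ge_sup; first by exists 0; exact: S0.
  move=> x Sx; apply: ub_le_sup => //.
  case: Sx => [->|[r [Ar tr ->]]]; first by left.
  by right; exists r; split => //; exact: le_trans tr.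
have QP t : A t -> Q t = P t.
  move=> At; apply/eqP; rewrite eq_le; apply/andP; split; last first.
    by apply: ub_le_sup => //; right; exists t.
  apply: ge_sup; first by exists 0; exact: S0.
  move=> x [->|[r [[Ar _] tr ->]]]; first exact: P0.
  exact: (regular_point_nonincreasing aP oP At.1 Ar tr).
have lQ : loc_integrable Q.
  apply: (@loc_integrable_dom _ (fun=> M')).
  - by move=> x y; apply: nonincreasing_measurable => // s t; exact: Qni.
  - exact: loc_integrable_cst.
  - move=> x y; exists 1 => t _; rewrite mul1r !ger0_norm//.
    by rewrite (le_trans (Q0 t)).
have QPae : Q = P %[ae mu in `[0, D]%classic].
  move: aeA; apply: filterS; first exact: (ae_filter_ringOfSetsType mu).
  by move=> t At tD; apply: QP; exact: At.
have PQae : P = Q %[ae mu in `[0, D]%classic] by exact: ae_eq_sym.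
have aQ : admissible Q by [].
by exists Q; split => //; exact: optimal_ae_eq PQae oP.
Qed.

(** * Optimal power once the critical temperature is reached *)

(** There is no thermal margin at time 0, so a value above pc at s > 0 would, by monotonicity,
    overheat on [0, s]. Hence the energy of Q is at most that of the constant policy, which is
    feasible; the first-order gain towards a constant is a nonnegative multiple of the energy
    difference, so the two agree. *)
Lemma optimal_critical_start Q : admissible Q -> opt Q ->
  (forall s t, s <= t -> Q t <= Q s) -> 0 < E -> Te < Tc -> T0 = Tc ->
  admissible (fun=> Num.min pc (E / D)) /\
  (fun=> Num.min pc (E / D)) = Q %[ae mu in `[0, D]%classic].
Proof.
move=> aQ oQ Qni E0 TeTc T0Tc; have [lQ Q0] := aQ.
have [/(feasibleP aQ)[EQ HQ] _] := oQ.
have lc := @loc_integrable_cst R.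
have Qpc s : 0 < s <= D -> Q s <= pc.
  move=> /andP[s0 sD]; rewrite leNgt; apply/negP => Qs.
  have : 0 < heat Q s.
    apply: (@lt_le_trans _ _ (integ (fun=> Q s - pc) 0 s)).
      by rewrite integ_cst ?subr0 ?mulr_gt0 ?subr_gt0// ltW.
    apply: le_integ => //; first exact: loc_integrable_excess.
    move=> r /andP[r0 rs]; have Qrs := Qni _ _ rs.
    apply: (@le_trans _ _ (Q r - pc)); first by rewrite lerD2r.
    rewrite ler_peMl// ?subr_ge0 ?(le_trans (ltW Qs))//.
    by rewrite -expR0 ler_expR mulr_ge0// ltW.
  apply/negP; rewrite -leNgt -(pmulr_rle0 _ a_gt0).
  apply: le_trans (HQ s _) _; first by rewrite ltW.
  by rewrite T0Tc subrr.
have IQ : integ Q 0 D <= pc * D.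
  rewrite -[leRHS](_ : integ (fun=> pc) 0 D = _); last first.
    by rewrite integ_cst ?subr0// ltW.
  by apply: le_integ_oo => // t /andP[t0 tD]; apply: Qpc; rewrite t0 ltW.
set m := Num.min pc (E / D).
have pc0 : 0 < pc by rewrite divr_gt0// mulr_gt0// subr_gt0.
have m0 : 0 <= m by rewrite le_min (ltW pc0) divr_ge0// ltW.
have am : admissible (fun=> m) by split.
split => //.
have ID : integ (fun=> m) 0 D = m * D by rewrite integ_cst ?subr0// ltW.
apply: (optimal_first_order aQ am oQ).
  apply/(feasibleP am); split.
    by rewrite ID -ler_pdivlMr// ge_min lexx orbT.
  move=> t /andP[t0 tD]; rewrite T0Tc subrr pmulr_rle0//.
  rewrite -[leRHS](_ : integ (fun=> 0) 0 t = 0); last by rewrite integ_cst ?mul0r.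
  apply: le_integ => //; first exact: loc_integrable_excess.
  move=> r _; rewrite pmulr_rle0 ?expR_gt0// subr_le0.
  by rewrite ge_min lexx.
have -> : (fun t => (m - Q t) / (1 + m)) = (fun t => (1 + m)^-1 * (m - Q t)).
  by apply/funext => t; rewrite mulrC.
rewrite integZ; last exact: loc_integrableB.
rewrite mulr_ge0 ?invr_ge0 ?addr_ge0// integB// subr_ge0 ID.
by rewrite minr_pMl ?(ltW D_gt0)// le_min IQ divfK ?gt_eqF.
Qed.

Lemma optimal_after_hitting Q th : admissible Q -> opt Q ->
  (forall s t, s <= t -> Q t <= Q s) -> 0 <= th < D ->
  a * heat Q th = Tc - T0 ->
  (forall s, 0 <= s < th -> a * heat Q s < Tc - T0) ->
  T0 < Tc ->
  (forall s, 0 <= s < th -> pc < Q s) /\ (forall t, th < t < D -> Q t = pc).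
Proof.
move=> aQ oQ Qni /andP[th0 thD] Hth Hlt T0Tc; have [lQ Q0] := aQ.
have [/(feasibleP aQ)[EQ HQ] _] := oQ.
have lc := @loc_integrable_cst R.
have lw := loc_integrable_excess lQ.
have heat_le s t : 0 <= s <= t -> (forall r, s < r < t -> Q r <= pc) ->
    heat Q t <= heat Q s.
  move=> st H; rewrite (excess_heat_add lQ st) gerDl.
  rewrite -[leRHS](_ : integ (fun=> 0) s t = 0); last first.
    by case/andP: st => _ st; rewrite integ_cst ?mul0r.
  apply: le_integ_oo => // r /H.
  by rewrite pmulr_rle0 ?expR_gt0// subr_le0.
(* If Q s <= pc, monotonicity keeps Q below pc from [s] on, and the heat could not rise to the cap
   at [th]. *)
have Qbefore s : 0 <= s < th -> pc < Q s.
  move=> sth; rewrite ltNge; apply/negP => Qs.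
  have := Hlt _ sth; apply/negP; rewrite -leNgt -Hth ler_pM2l//.
  case/andP: sth => s0 sth; apply: heat_le; first by rewrite s0 ltW.
  by move=> r /andP[sr _]; apply: le_trans Qs; apply: Qni; exact: ltW.
(* If Q t > pc, then Q > pc on all of [th, t], and the heat would exceed the cap reached at [th]. *)
have Qafter t : th < t <= D -> Q t <= pc.
  move=> /andP[tht tD]; rewrite leNgt; apply/negP => Qt.
  have : heat Q th < heat Q t.
    rewrite (excess_heat_add (P := Q) (s := th) (t := t))// ?th0 ?(ltW tht)// ltrDl.
    apply: (@lt_le_trans _ _ (integ (fun=> Q t - pc) th t)).
      by rewrite integ_cst ?(ltW tht)// mulr_gt0 ?subr_gt0.
    apply: le_integ => // r /andP[thr rt]; have Qrs := Qni _ _ rt.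
    apply: (@le_trans _ _ (Q r - pc)); first by rewrite lerD2r.
    rewrite ler_peMl// ?subr_ge0 ?(le_trans (ltW Qt))//.
    by rewrite -expR0 ler_expR mulr_ge0// ?(ltW b_gt0)// (le_trans th0).
  apply/negP; rewrite -leNgt -(ler_pM2l a_gt0) Hth; apply: HQ.
  by rewrite tD andbT (le_trans th0)// ltW.
split=> // t1 /andP[tht1 t1D]; apply/eqP; rewrite eq_le Qafter; last first.
  by rewrite tht1 ltW.
rewrite leNgt; apply/negP => Qt1.
have th_gt0 : 0 < th.
  rewrite lt_neqAle th0 andbT; apply/eqP => th00.
  move: Hth; rewrite -th00 /excess_heat integxx mulr0 => /eqP.
  by rewrite lt_eqF// subr_gt0.
pose p r := Q r - pc.
have lp : loc_integrable p by exact: loc_integrableB.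
(* Cumulative surplus over pc. It increases strictly up to [th] and ends strictly lower at [D]; the
   strict drop uses Q < pc on [t1, D], an interval of positive length because t1 < D. *)
pose W := integ p 0.
have Wadd s t : 0 <= s <= t -> W t = W s + integ p s t by exact: integ_add.
have W0 : W 0 = 0 by rewrite /W integxx.
have Wth s : 0 <= s < th -> W s < W th.
  move=> /andP[s0 sth]; pose h := (s + th) / 2.
  have sh : s < h by rewrite /h; lra.
  have hth : h < th by rewrite /h; lra.
  rewrite (Wadd s th) ?s0 ?(ltW sth)// ltrDl.
  have shth : s <= h <= th by rewrite !ltW.
  rewrite (integ_add lp shth).
  have i1 : 0 < integ p s h.
    apply: (@lt_le_trans _ _ (integ (fun=> p h) s h)).
      rewrite integ_cst ?(ltW sh)// mulr_gt0 ?subr_gt0// Qbefore// hth andbT.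
      by rewrite (le_trans s0)// ltW.
    by apply: le_integ => // r /andP[_ rh]; rewrite lerD2r; exact: Qni.
  have i2 : 0 <= integ p h th.
    rewrite -[leLHS](_ : integ (fun=> 0) h th = 0); last first.
      by rewrite integ_cst ?mul0r// ltW.
    apply: le_integ_oo => // r /andP[hr rth]; rewrite subr_ge0 ltW// Qbefore//.
    by rewrite rth andbT; lra.
  lra.
have WD : W D < W th.
  rewrite (Wadd th D) ?th0 ?ltW// gtrDl.
  have tt1D : th <= t1 <= D by rewrite !ltW.
  rewrite (integ_add lp tt1D).
  have i1 : integ p th t1 <= 0.
    rewrite -[leRHS](_ : integ (fun=> 0) th t1 = 0); last first.
      by rewrite integ_cst ?mul0r// ltW.
    apply: le_integ_oo => // r /andP[hr rth]; rewrite subr_le0 Qafter//.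
    by rewrite hr; lra.
  have i2 : integ p t1 D < 0.
    apply: (@le_lt_trans _ _ (integ (fun=> p t1) t1 D)).
      by apply: le_integ => // r /andP[rh _]; rewrite lerD2r; exact: Qni.
    by rewrite integ_cst ?(ltW t1D)// nmulr_rlt0 ?subr_gt0// subr_lt0.
  lra.
(* A level below the peak W th and above both end values is attained on each side of [th]; equal
   values of W at [s] and [u] mean that the mean power between them is pc. *)
have [L [L0 LWD LW]] : exists L, [/\ 0 <= L, W D <= L & L < W th].
  exists (Num.max 0 (W D)); rewrite !le_max !lexx orbT; split => //.
  by rewrite gt_max WD -W0 Wth// lexx.
have cW x y : 0 <= x <= y -> {within `[x, y], continuous W}.
  move=> /andP[x0 xy].
  have := continuous_integ (le_trans x0 xy) lp.
  by apply: continuous_subspaceW; exact: subset_itvScc.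
have [||s] := @IVT _ W 0 th L th0.
- by apply: cW; rewrite lexx.
- by rewrite W0 ge_min le_max L0 (ltW LW) orbT.
rewrite in_itv/= => /andP[s0 sth] Ws.
have [||u] := @IVT _ W th D L (ltW thD).
- by apply: cW; rewrite th0 ltW.
- by rewrite ge_min le_max LWD (ltW LW) !orbT.
rewrite in_itv/= => /andP[thu uD] Wu.
have sth' : s < th.
  by rewrite lt_neqAle sth andbT; apply/eqP => E1; move: LW; rewrite -Ws E1 ltxx.
have thu' : th < u.
  by rewrite lt_neqAle thu andbT; apply/eqP => E1; move: LW; rewrite -Wu E1 ltxx.
have su : s < u by exact: lt_trans thu'.
have Isu : integ Q s u = pc * (u - s).
  have : integ p s u = 0.
    have s0u : 0 <= s <= u by rewrite s0 ltW.
    have := Wadd _ _ s0u; rewrite Ws Wu; lra.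
  by rewrite integB// integ_cst ?(ltW su)//; lra.
have su0 : 0 <= s < u by rewrite s0.
have sD : 0 <= s <= D by rewrite s0 (le_trans (ltW su)).
have H1 t : s <= t <= u -> a * (heat Q s + (pc - pc) *
    integ (fun tau => expR (b * tau)) s t) <= Tc - T0.
  by move=> _; rewrite subrr mul0r addr0; exact: HQ.
have H2 t : u <= t <= D -> a * (heat Q s + (pc - pc) *
    integ (fun tau => expR (b * tau)) s u + integ (weight Q) u t) <= Tc - T0.
  move=> /andP[ut tD]; rewrite subrr mul0r addr0; apply: le_trans (HQ _ sD).
  rewrite ler_pM2l// gerDl.
  rewrite -[leRHS](_ : integ (fun=> 0) u t = 0); last by rewrite integ_cst ?mul0r.
  apply: le_integ_oo => // r /andP[ur rt].
  rewrite pmulr_rle0 ?expR_gt0// subr_le0 Qafter// (lt_trans thu')//=.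
  by rewrite (le_trans (ltW rt)).
(* Rigidity would make W constant from [s] to [th], against its strict increase. *)
have := average_rigid aQ oQ su0 uD Isu H1 H2 (t := th).
rewrite sth thu => /(_ isT) Ith.
have sth0 : 0 <= s < th by rewrite s0.
have := Wth s sth0.
have s0th : 0 <= s <= th by rewrite s0.
rewrite (Wadd _ _ s0th) integB// Ith integ_cst// subrr addr0.
by rewrite ltxx.
Qed.

(** * Shape of the temperature curve *)

(** Variation of constants around Te + a q / b, the equilibrium temperature under constant power
    [q]. *)
Lemma temperature_step Q s t q : loc_integrable Q -> 0 <= s <= t ->
  expR (b * t) * (temp Q t - (Te + a * q / b)) =
  expR (b * s) * (temp Q s - (Te + a * q / b)) +
    a * integ (fun r => expR (b * r) * (Q r - q)) s t.
Proof.
move=> lQ st; have /andP[s0 st'] := st.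
have lw := loc_integrable_excess lQ.
have le := @loc_integrable_expR R b.
have inv r : expR (b * r) * expR (- b * r) = 1.
  by rewrite -expRD mulNr addrN expR0.
have tE r : 0 <= r -> expR (b * r) * (temp Q r - (Te + a * q / b)) =
    expR (b * r) * (Tc - (Te + a * q / b)) - (Tc - T0 - a * heat Q r).
  move=> r0; rewrite temperatureE//.
  rewrite -[in RHS](mul1r (Tc - T0 - _)) -(inv r); ring.
have -> : integ (fun r => expR (b * r) * (Q r - q)) s t =
  integ (weight Q) s t + (pc - q) * ((expR (b * t) - expR (b * s)) / b).
  rewrite -integ_expR ?gt_eqF// -integZ// -integD//; last exact: loc_integrableZ.
  by apply: eq_integ => r _; ring.
rewrite !tE//; last exact: le_trans st'.
rewrite (excess_heat_add lQ st) /critical_power.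
by field; rewrite !gt_eqF.
Qed.

(* With the power frozen at [Q t], the temperature would be an exponential
   through [(t, temp Q t)], which dominates the actual one on both sides by
   monotonicity of [Q] and is concave, hence below its tangent. *)
Lemma temperature_tangent Q s t : loc_integrable Q ->
  (forall r r', 0 <= r -> r <= r' <= D -> Q r' <= Q r) ->
  0 <= s <= D -> 0 <= t <= D -> pc <= Q t -> temp Q t <= Tc ->
  let v := temp Q t - (Te + a * Q t / b) in
  v <= 0 /\ temp Q s <= temp Q t - b * v * (s - t).
Proof.
move=> lQ Qni /andP[s0 sD] /andP[t0 tD] pcQ TTc v.
(* Power at least pc has an equilibrium temperature of at least Tc. *)
have v0 : v <= 0.
  have : Tc - Te <= a * Q t / b.
    rewrite ler_pdivlMr// -ler_pdivrMl// (le_trans _ pcQ)//.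
    by rewrite /critical_power mulrC.
  rewrite /v; lra.
split=> //.
have lc := @loc_integrable_cst R.
have key : temp Q s - (Te + a * Q t / b) <= expR (b * (t - s)) * v.
  rewrite -(ler_pM2l (expR_gt0 (b * s))) mulrA -expRD.
  have -> : b * s + b * (t - s) = b * t by ring.
  have lQt : loc_integrable (fun r => expR (b * r) * (Q r - Q t)).
    by apply: loc_integrable_expM; [exact: ltW|exact: loc_integrableB].
  have [st|ts] := leP s t.
    have s0t : 0 <= s <= t by rewrite s0.
    rewrite /v (temperature_step (Q t) lQ s0t) lerDl pmulr_rge0//.
    apply: integ_ge0 => r /andP[sr rt]; rewrite mulr_ge0 ?expR_ge0// subr_ge0.
    by apply: Qni; rewrite ?rt// (le_trans s0).
  have t0s : 0 <= t <= s by rewrite t0 ltW.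
  rewrite (temperature_step (Q t) lQ t0s) gerDl pmulr_rle0//.
  rewrite -[leRHS](_ : integ (fun=> 0) t s = 0); last first.
    by rewrite integ_cst ?mul0r// ltW.
  apply: le_integ => // r /andP[tr rs].
  rewrite pmulr_rle0 ?expR_gt0// subr_le0.
  by apply: Qni => //; rewrite tr (le_trans rs).
have e1 := expR_ge1Dx (b * (t - s)).
have : expR (b * (t - s)) * v <= (1 + b * (t - s)) * v.
  by rewrite ler_wnM2r.
move: key; rewrite /v; lra.
Qed.

Lemma temperature_eq P t : loc_integrable P -> 0 <= t ->
  temp P t = Tc <-> a * heat P t = Tc - T0.
Proof.
move=> lP t0; rewrite temperatureE//.
split => [|->]; last by rewrite subrr mulr0 subr0.
move=> /eqP; rewrite -subr_eq0 addrAC subrr sub0r oppr_eq0 mulf_eq0.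
by rewrite gt_eqF ?expR_gt0//= subr_eq0 => /eqP.
Qed.

(** Through each point of the curve passes a line of nonnegative slope that stays above the curve;
    this gives both properties without differentiating the temperature at jumps of Q. *)
Lemma temperature_monotone_concave Q : loc_integrable Q ->
  (forall r r', 0 <= r -> r <= r' <= D -> Q r' <= Q r) ->
  (forall t, 0 <= t <= D -> pc <= Q t /\ temp Q t <= Tc) ->
  {in `[0, D] &, nondecreasing_fun (temp Q)} /\
  concave_function `[0, D] (temp Q).
Proof.
move=> lQ Qni HQ; split.
  move=> s t; rewrite !in_itv/= => sD tD st; have [pcQ TTc] := HQ _ tD.
  have [v0 tgt] := temperature_tangent lQ Qni sD tD pcQ TTc.
  apply: le_trans tgt _; rewrite gerBl; apply: mulr_le0; last by rewrite subr_le0.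
  by rewrite pmulr_rle0.
move=> l x y; rewrite !inE/= !in_itv/= => xD yD.
pose w : R := conv l x y; rewrite -/w.
have wE : w = l%:num * x + (1 - l%:num) * y.
  exact: (convRE (x : R^o) (y : R^o) l).
have [l0 l1] : 0 <= l%:num /\ l%:num <= 1 by [].
have l1' : 0 <= 1 - l%:num by rewrite subr_ge0.
have wD : 0 <= w <= D.
  move: xD yD => /andP[x0 xD] /andP[y0 yD]; rewrite wE; apply/andP; split; nra.
have [pcQ TTc] := HQ _ wD.
have [_ tx] := temperature_tangent lQ Qni xD wD pcQ TTc.
have [_ ty] := temperature_tangent lQ Qni yD wD pcQ TTc.
rewrite [leRHS](convRE (- temp Q x : R^o) (- temp Q y : R^o) l) /=.
rewrite !mulrN -opprD lerN2.
move: tx ty; set v := _ - (_ + _) => tx ty.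
have := ler_wpM2l l0 tx; have := ler_wpM2l l1' ty => hy hx.
apply: le_trans (lerD hx hy) _; rewrite le_eqVlt; apply/orP; left; apply/eqP.
by rewrite wE; ring.
Qed.

End Policies.

Theorem lemma17 (R : realType) (D E a b Te Tc T0 : R)
    (D_gt0 : 0 < D) (E_gt0 : 0 < E) (a_gt0 : 0 < a) (b_gt0 : 0 < b)
    (Te_lt_Tc : Te < Tc) (T0_bounds : Te <= T0 <= Tc)
    (P : R -> R) (P_opt : optimal D E a b Te Tc T0 P) :
  let Td := Tc - Te in
  exists Q : R -> R,
    [/\ optimal D E a b Te Tc T0 Q,
        Q = P %[ae (@lebesgue_measure R) in `[0, D]%classic],
        Te < T0 < Tc ->
          let T := temperature a b Te T0 Q in
          {in `[0, D] &, nonincreasing_fun Q} /\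
          forall th : R, is_min [set t | t \in `[0, D] /\ T t = Tc] th ->
            th < D ->
            [/\ {in `[th, D], forall t, Q t = Td * b / a},
                {in `[0, D] &, nondecreasing_fun T} &
                concave_function `[0, D] T] &
        T0 = Tc ->
          {in `[0, D], forall t, Q t = Num.min (Td * b / a) (E / D)}].
Proof.
move=> Td.
have [P1 [aP1 oP1 P1P]] := optimal_admissible P_opt.
have [Q [aQ oQ QP1 Qni]] :=
  nonincreasing_representative D_gt0 a_gt0 b_gt0 aP1 oP1.
have [lQ Q0] := aQ.
have QP : Q = P %[ae (@lebesgue_measure R) in `[0, D]%classic].
  exact: ae_eq_trans P1P.
have [T0Tc|T0Tc] := eqVneq T0 Tc.
  have [am mQ] := optimal_critical_start D_gt0 a_gt0 b_gt0 aQ oQ Qni E_gt0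
    Te_lt_Tc T0Tc.
  exists (fun=> Num.min (Td * b / a) (E / D)); split => //.
  - by apply: (optimal_ae_eq a_gt0 b_gt0 aQ am _ oQ); exact: ae_eq_sym.
  - exact: ae_eq_trans QP.
  - by rewrite T0Tc ltxx andbF.
have {T0_bounds}T0Tc : T0 < Tc by rewrite lt_neqAle T0Tc; case/andP: T0_bounds.
pose T := temperature a b Te T0 Q.
(* If the cap is not reached before [D], monotonicity is the only claim and [Q] itself will do. *)
have [[th [[[thin Tth] thlb] thD]]|noth] := pselect (exists th,
    is_min [set t | t \in `[0, D] /\ T t = Tc] th /\ th < D); last first.
  exists Q; split => //; last by move=> E1; move: T0Tc; rewrite E1 ltxx.
  move=> _; split; first by move=> s t _ _; exact: Qni.
  by move=> th thmin thD; exfalso; apply: noth; exists th.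
move: thin; rewrite in_itv/= => /andP[th0 _].
have [_ TQ _] := oQ.1.
have thD0 : 0 <= th < D by rewrite th0.
have heat_th := (temperature_eq Te Tc T0 a_gt0 b_gt0 lQ th0).1 Tth.
have heat_lt s : 0 <= s < th -> a * excess_heat a b Te Tc Q s < Tc - T0.
  move=> /andP[s0 sth]; have sD : s \in `[0, D].
    by rewrite in_itv/= s0 (le_trans (ltW sth))// ltW.
  rewrite lt_neqAle -(temperature_le Te Tc T0 a_gt0 b_gt0 lQ s0) TQ// andbT.
  apply/eqP => /(temperature_eq Te Tc T0 a_gt0 b_gt0 lQ s0) Ts.
  by have := thlb s; rewrite leNgt sth => H; have := H (conj sD Ts).
have [Qlt Qeq] := optimal_after_hitting a_gt0 b_gt0 aQ oQ Qni thD0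
  heat_th heat_lt T0Tc.
pose pc := critical_power a b Te Tc.
have pc0 : 0 <= pc.
  by rewrite ltW// divr_gt0// mulr_gt0// subr_gt0.
(* [Q] is known to equal pc only strictly between [th] and [D]; the values at these two points are
   corrected, on a null set and without losing monotonicity. *)
pose Q2 t := if t \in `[th, D] then pc else Q t.
have aQ2 : admissible Q2.
  split; first by apply: loc_integrable_if => //; exact: loc_integrable_cst.
  by move=> t; rewrite /Q2; case: ifP.
have Q2Q : Q2 = Q %[ae (@lebesgue_measure R) in `[0, D]%classic].
  have := ae_neq th; apply: filter_app.
    exact: (ae_filter_ringOfSetsType (@lebesgue_measure R)).
  have := ae_neq D; apply: filterS.
    exact: (ae_filter_ringOfSetsType (@lebesgue_measure R)).
  move=> t tD tth _; rewrite /Q2; case: ifP => //.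
  rewrite in_itv/= => /andP[tht tD'].
  by rewrite Qeq// !lt_neqAle tht tD' tD eq_sym tth.
have oQ2 : optimal D E a b Te Tc T0 Q2.
  by apply: (optimal_ae_eq a_gt0 b_gt0 aQ aQ2 _ oQ); exact: ae_eq_sym.
have Q2in t : th <= t <= D -> Q2 t = pc by rewrite /Q2 in_itv/= => ->.
have Q2out t : t < th -> Q2 t = Q t.
  by move=> tth; rewrite /Q2 in_itv/= [th <= t]leNgt tth.
have Q2ni r r' : 0 <= r -> r <= r' <= D -> Q2 r' <= Q2 r.
  move=> r0 /andP[rr' r'D]; have [r'th|thr'] := ltP r' th.
    by rewrite !Q2out ?(le_lt_trans rr')//; exact: Qni.
  rewrite Q2in ?thr'//; have [rth|thr] := ltP r th.
    by rewrite Q2out// ltW// Qlt// r0.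
  by rewrite Q2in// thr (le_trans rr').
have Q2pc t : 0 <= t <= D -> pc <= Q2 t.
  move=> /andP[t0 tD]; have [tth|tht] := ltP t th.
    by rewrite Q2out// ltW// Qlt// t0.
  by rewrite Q2in// tht.
have TE t : t \in `[0, D] -> temperature a b Te T0 Q2 t = T t.
  rewrite in_itv/= => /andP[t0 tD].
  rewrite /T !(temperatureE Te Tc T0 a_gt0 b_gt0)//; last exact: aQ2.1.
  by rewrite (excess_heat_ae_eq a Te Tc b_gt0 aQ2.1 lQ Q2Q tD).
exists Q2; split => //.
- exact: ae_eq_trans QP.
- move=> _; split.
    move=> r r'; rewrite !in_itv/= => /andP[r0 _] /andP[_ r'D] rr'.
    by apply: Q2ni => //; rewrite rr'.
  move=> th' [[th'D Tth'] th'lb] _.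
  (* The correction leaves the temperature unchanged on [0, D], hence also the hitting time. *)
  have -> : th' = th.
    apply/eqP; rewrite eq_le; apply/andP; split.
      have thD' : th \in `[0, D] by rewrite in_itv/= th0 ltW.
      by apply: th'lb; split => //; rewrite TE.
    by apply: thlb; split => //; rewrite -TE.
  have [_ TQ2 _] := oQ2.1.
  have Q2T t : 0 <= t <= D -> pc <= Q2 t /\ temperature a b Te T0 Q2 t <= Tc.
    by move=> tD; split; [exact: Q2pc|apply: TQ2; rewrite in_itv].
  have [Tnd Tcv] := temperature_monotone_concave a_gt0 b_gt0 aQ2.1 Q2ni Q2T.
  by split => // t; rewrite in_itv/=; exact: Q2in.
- by move=> E1; move: T0Tc; rewrite E1 ltxx.
Qed.
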